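(* There exists an invertible non-hypercyclic bilateral weighted shift $T$ acting on $\ell_2(\mathbb{Z})$ such that both $T$ and $T^{-1}$ are weakly hypercyclic.
   Context: All spaces are complex. Given a bounded sequence $\{w_n\}_{n\in\mathbb{Z}}$ in $\mathbb{C}\setminus\{0\}$ (the weight sequence), the bilateral weighted shift $T$ on $\ell_2(\mathbb{Z})$ is the bounded linear operator defined on the canonical basis $\{e_n\}_{n\in\mathbb{Z}}$ by $Te_n=w_ne_{n-1}$. Invertible means having a bounded inverse. A bounded linear operator $T$ on a Banach space $\mathcal{B}$ is hypercyclic (weakly hypercyclic) if for some $x\in\mathcal{B}$ the orbit $\{T^nx:n=0,1,2,\dots\}$ is norm dense (weakly dense) in $\mathcal{B}$. *)

(* Defs.v *)
From HB Require Import structures.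
From mathcomp Require Import all_boot all_order all_algebra.
From mathcomp Require Import all_classical all_reals.
From mathcomp Require Import ereal topology normedtype esum.
From mathcomp Require Import complex.
From mathcomp Require Import ring lra.

Set Implicit Arguments.
Unset Strict Implicit.
Unset Printing Implicit Defensive.

Import Order.TTheory GRing.Theory Num.Theory.
Import ComplexField.Normc.

Local Open Scope classical_set_scope.
Local Open Scope ring_scope.
Local Open Scope complex_scope.

Section ell2_sum.
Variable R : realType.
Implicit Types x y : int -> R[i].

Definition ell2_sum x : \bar R := \esum_(n in [set: int]) (normc (x n) ^+ 2)%:E.

Lemma ell2_sum_ge0 x : (0 <= ell2_sum x)%E.
Proof. by apply: esum_ge0 => n _; rewrite lee_fin sqr_ge0. Qed.

Lemma ell2_sum_ge x n : ((normc (x n) ^+ 2)%:E <= ell2_sum x)%E.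
Proof.
apply: esum_ge; exists [set n]; last by rewrite fsbig_set1.
by split; [exact: finite_set1|].
Qed.

Lemma esumZl_fin (f : int -> R) (c : R) : 0 <= c -> (forall n, 0 <= f n) ->
  (\esum_(n in [set: int]) (c * f n)%:E =
   c%:E * \esum_(n in [set: int]) (f n)%:E)%E.
Proof.
move=> c0 f0; rewrite /esum -ereal_supZl //; last first.
  by apply/set0P; eexists; exists set0; first exact: fsets_set0.
congr ereal_sup; rewrite image_comp; apply: eq_imagel => A _ /=.
by rewrite ge0_mule_fsumr// => n; rewrite lee_fin.
Qed.

Lemma normcZ_ge0 (z : R[i]) : 0 <= normc z.
Proof. by case: z => a b; exact: sqrtr_ge0. Qed.

Lemma ell2_sumZ (a : R[i]) x :
  ell2_sum (a *: x) = ((normc a ^+ 2)%:E * ell2_sum x)%E.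
Proof.
rewrite -esumZl_fin ?sqr_ge0// => [|n]; last exact: sqr_ge0.
by apply: eq_esum => n _; rewrite [normc _]normcM exprMn.
Qed.

Lemma ell2_sum0 : ell2_sum 0 = 0%E.
Proof. by apply: esum1 => n _; rewrite [normc _]normc0 expr0n. Qed.

(* Pointwise, |a + b|^2 <= (1 + t) |a|^2 + (1 + 1/t) |b|^2. *)
Lemma ell2_sumD x y (t : R) : 0 < t ->
  (ell2_sum (x + y)%R
     <= (1 + t)%:E * ell2_sum x + (1 + t^-1)%:E * ell2_sum y)%E.
Proof.
move=> t0; have ti0 : 0 < t^-1 by rewrite invr_gt0.
have s0 : 0 <= 1 + t by rewrite addr_ge0 ?ler01// ltW.
have r0 : 0 <= 1 + t^-1 by rewrite addr_ge0 ?ler01// ltW.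
rewrite -!esumZl_fin// => [|n|n]; try exact: sqr_ge0.
rewrite -esumD => [|n _|n _]; last 2 first.
- by rewrite lee_fin mulr_ge0// sqr_ge0.
- by rewrite lee_fin mulr_ge0// sqr_ge0.
apply: le_esum => n _; rewrite -EFinD lee_fin.
have := le_normcD (x n : Rcomplex R) (y n : Rcomplex R); rewrite -[(x + y) n]/(x n + y n).
move: (normcZ_ge0 (x n + y n)) (normcZ_ge0 (x n)) (normcZ_ge0 (y n)).
move: (normc _) (normc (x n)) (normc (y n)) => c a b c0 a0 b0 cab.
apply: (@le_trans _ _ ((a + b) ^+ 2)); first by rewrite ler_sqr ?nnegrE ?addr_ge0.
have := sqr_ge0 (t * a - b); rewrite -(pmulr_rge0 _ ti0) => h.
rewrite -subr_ge0; apply: le_trans h _; rewrite le_eqVlt; apply/orP; left.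
by apply/eqP; field; rewrite gt_eqF.
Qed.

Definition ell2_pred : {pred int -> R[i]} := fun x => (ell2_sum x < +oo)%E.

Lemma ell2_submod_closed : @submod_closed R[i] (int -> R[i]) ell2_pred.
Proof.
split=> [|a x y xP yP]; first by rewrite unfold_in ell2_sum0 ltry.
rewrite unfold_in; apply: (le_lt_trans (ell2_sumD _ _ ltr01)).
have c0 (s : R) : 0 < s -> 0 <= 1 + s by move=> s0; rewrite addr_ge0 ?ltW.
apply: lte_add_pinfty; apply: lte_mul_pinfty; rewrite ?lee_fin ?c0 ?invr_gt0//.
by rewrite ell2_sumZ lte_mul_pinfty// lee_fin sqr_ge0.
Qed.

HB.instance Definition _ :=
  GRing.isSubmodClosed.Build R[i] (int -> R[i]) ell2_pred ell2_submod_closed.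

End ell2_sum.

Record ell2 (R : realType) := Ell2 {
  ell2_fun :> int -> R[i];
  ell2_funP : ell2_fun \in @ell2_pred R }.

Section ell2_structure.
Variable R : realType.

HB.instance Definition _ := [isSub for @ell2_fun R].
HB.instance Definition _ := [Choice of ell2 R by <:].
HB.instance Definition _ := [SubChoice_isSubLmodule of ell2 R by <:].

Implicit Types x y : ell2 R.

Definition ell2_rnorm x : R := Num.sqrt (fine (ell2_sum x)).

(* In a normedModType over R[i] norms are (nonnegative real) elements of R[i]. *)
Definition ell2_norm x : R[i] := (ell2_rnorm x)%:C.

Lemma ell2_rnormE x : ell2_sum x = (ell2_rnorm x ^+ 2)%:E.
Proof.
rewrite sqr_sqrtr ?fine_ge0 ?ell2_sum_ge0// fineK// ge0_fin_numE ?ell2_sum_ge0//.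
exact: ell2_funP.
Qed.

Lemma ell2_rnormD x y : ell2_rnorm (x + y) <= ell2_rnorm x + ell2_rnorm y.
Proof.
have nx : 0 <= ell2_rnorm x := sqrtr_ge0 _.
have ny : 0 <= ell2_rnorm y := sqrtr_ge0 _.
have H (t : R) : 0 < t -> ell2_rnorm (x + y) ^+ 2 <=
    (1 + t) * ell2_rnorm x ^+ 2 + (1 + t^-1) * ell2_rnorm y ^+ 2.
  move=> /(ell2_sumD x y); rewrite -[X in ell2_sum X]/(ell2_fun (x + y)).
  by rewrite !ell2_rnormE -!EFinM -EFinD lee_fin.
(* The optimal t is |y| / |x|; shifting both norms by e > 0 makes it legal. *)
apply/ler_addgt0Pr => e e0; set a := ell2_rnorm x; set b := ell2_rnorm y.
have a1 : 0 < a + e / 2 by rewrite ltr_wpDl ?divr_gt0.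
have b1 : 0 < b + e / 2 by rewrite ltr_wpDl ?divr_gt0.
have t0 := divr_gt0 b1 a1.
rewrite (_ : a + b + e = (a + e / 2) + (b + e / 2)); last by field.
have ab0 : 0 <= (a + e / 2) + (b + e / 2) by rewrite ltW// addr_gt0.
rewrite -ler_sqr ?nnegrE ?ab0 ?sqrtr_ge0//.
apply: le_trans (H _ t0) _; rewrite -/a -/b.
have aE : a ^+ 2 <= (a + e / 2) ^+ 2.
  by rewrite ler_sqr ?nnegrE ?(ltW a1)// lerDl ltW ?divr_gt0.
have bE : b ^+ 2 <= (b + e / 2) ^+ 2.
  by rewrite ler_sqr ?nnegrE ?(ltW b1)// lerDl ltW ?divr_gt0.
move: {H} (a + e / 2) (b + e / 2) a1 b1 t0 aE bE => a' b' a1 b1 t0 aE bE.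
apply: (@le_trans _ _ ((1 + b' / a') * a' ^+ 2 + (1 + (b' / a')^-1) * b' ^+ 2)).
  by rewrite lerD// ler_wpM2l// addr_ge0// ltW ?invr_gt0.
by rewrite le_eqVlt; apply/orP; left; apply/eqP; field; rewrite !gt_eqF.
Qed.

Let ell2_normD x y : ell2_norm (x + y) <= ell2_norm x + ell2_norm y.
Proof. by rewrite -rmorphD lecR ell2_rnormD. Qed.

Let ell2_normZ (a : R[i]) x : ell2_norm (a *: x) = `|a| * ell2_norm x.
Proof.
rewrite (_ : `|a| = (normc a)%:C)// -rmorphM; congr (_ %:C).
apply/eqP; rewrite -(@eqrXn2 _ 2)// ?mulr_ge0 ?sqrtr_ge0 ?normcZ_ge0//.
rewrite -(inj_eq (@EFin_inj R)) -ell2_rnormE exprMn EFinM -ell2_rnormE.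
by rewrite -ell2_sumZ.
Qed.

Let ell2_norm0_eq0 x : ell2_norm x = 0 -> x = 0.
Proof.
move=> /(@complexI R) x0; apply: val_inj; apply/funext => n /=.
have := ell2_sum_ge x n; rewrite ell2_rnormE x0 lee_fin expr0n /=.
rewrite le_eqVlt ltNge sqr_ge0 orbF sqrf_eq0 => /eqP.
exact: eq0_normc.
Qed.

HB.instance Definition _ :=
  @Lmodule_isNormed.Build R[i] (ell2 R) ell2_norm ell2_normD ell2_normZ
    ell2_norm0_eq0.

Lemma ell2_normE x :
  `|x| = (Num.sqrt (fine (\esum_(n in [set: int]) (normc (x n) ^+ 2)%:E)))%:C.
Proof. by []. Qed.

Let ell2_basis_fun (n : int) : int -> R[i] := fun m => (m == n)%:R.

Let ell2_basis_subproof n : ell2_basis_fun n \in @ell2_pred R.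
Proof.
rewrite unfold_in /ell2_sum (esumID [set n])//; last first.
  by move=> m _; rewrite lee_fin sqr_ge0.
rewrite setTI esum_set1 ?lee_fin ?sqr_ge0// esum1 ?adde0 ?ltry//.
by move=> m [_ /eqP/negPf mn]; rewrite /ell2_basis_fun mn normc0 expr0n.
Qed.

Definition ell2_basis (n : int) : ell2 R := Ell2 (ell2_basis_subproof n).

Lemma ell2_basisE n m : ell2_basis n m = (m == n)%:R.
Proof. by []. Qed.

End ell2_structure.

Section operators.
Variables (K : numFieldType) (V : normedModType K).

Definition bounded_operator (T : {linear V -> V}) :=
  exists M : K, forall x, `|T x| <= M * `|x|.

Definition inverse_operator (T S : {linear V -> V}) :=
  [/\ cancel T S, cancel S T & bounded_operator S].

Definition topological_dual := {f : {linear V -> K^o} | continuous f}.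

(* V with its weak topology, the coarsest one making every element of the
   topological dual continuous. *)
Definition weak_space : topologicalType :=
  sup_topology (fun f : topological_dual =>
    Topological.on (initial_topology (sval f))).

Definition orbit (T : V -> V) (x : V) : set V := range (fun n => iter n T x).

Definition hypercyclic (T : V -> V) := exists x, dense (orbit T x).

Definition weakly_hypercyclic (T : V -> V) :=
  exists x, @dense weak_space (orbit T x).

End operators.

Definition bilateral_weighted_shift (R : realType)
    (T : {linear ell2 R -> ell2 R}) :=
  exists w : int -> R[i],
    [/\ bounded_fun (w : int -> R[i]^o), (forall n, w n != 0), bounded_operator T &
        forall n, T (ell2_basis R n) = w n *: ell2_basis R (n - 1)].

(* Main.v *)
Require Import Defs.
From HB Require Import structures.
From mathcomp Require Import all_boot all_order all_algebra.
From mathcomp Require Import all_classical all_reals.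
From mathcomp Require Import ereal topology normedtype esum sequences.
From mathcomp Require Import complex.
From mathcomp Require Import ring lra zify.

Set Implicit Arguments.
Unset Strict Implicit.
Unset Printing Implicit Defensive.

Import Order.TTheory GRing.Theory Num.Theory.
Import ComplexField.Normc.

Local Open Scope classical_set_scope.
Local Open Scope ring_scope.
Local Open Scope complex_scope.


(** Take positive weights [gam i = 2 ^- h i], with [h : int -> nat] 1-Lipschitz,
    and the shift [T] with [T^n x (i) = gam i / gam (i + n) * x (i + n)].  On
    the quotients [x i / gam i] the operator [T] is a plain translation, so [T]
    is invertible with [T^-1] of the same form, and everything is decided by
    where [h] is large.  Here [h] consists of tents that grow geometrically and
    are placed alternately on the positive and on the negative half-line, so
    that [h n = 0] or [h (- n) = 0] for every [n].

    [T] is not hypercyclic ([wshift_not_hypercyclic]).  If [T^n x] were close to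
    a large multiple of [e_0], its coordinate [0], which is [x n / gam n], would
    be large, while its coordinate [p - n], which is comparable to
    [gam (- n) * x p], would be small.  One of [gam n], [gam (- n)] is [1]: the
    first case contradicts [x] having finite norm, the second [x p] not being
    zero.

    Both [T] and [T^-1] are weakly hypercyclic ([weakly_dense_translates]).  Let
    [n_j] be a lacunary sequence inside the tents of one half-line, and let [x]
    be [gam] times the sum of finitely supported [y_j], copy [j] being placed at
    [n_j] and made tiny there by [gam].  Then [T^(n_k) x = u_k + z_k + r_k]:
    here [z_k = gam * y_k] is the target of time [k]; [r_k], the later copies,
    tends to [0]; and [u_k], the earlier copies already moved past the origin,
    need not be small but has norm at most of order [sqrt k], as [gam <= 1].
    Lacunarity makes the [u_k] disjointly supported, hence orthogonal; by
    Bessel's inequality a continuous functional that is at least [e] in modulus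
    on all [u_k] with [k] in some set [A] forces the sum of [1 / |u_k|^2] over
    [A] to be finite. If every target recurs along an arithmetic progression [A]
    and the mean of the [|y_j|^2] stays bounded, this sum dominates a harmonic
    series ([gauge_small_along]). So every target is a weak accumulation point
    of the orbit.

    The schedule gives level [logn 2 j] to the [j]-th time: a level recurs along
    the odd multiples of a power of 2, and the mean of [logn 2 j] is at most [1],
    so a squared norm bounded by the level plus one is affordable.  The two
    directions are served by the tents of the two half-lines. *)

(** * Vectors of l2 *)

Section ell2_vectors.
Variable R : realType.
Implicit Types (x y : ell2 R) (a z : R[i]).

Lemma normc_complex (c : R) : normc c%:C = `|c|.
Proof. by rewrite /normc /= expr0n addr0 sqrtr_sqr. Qed.

Lemma normcD_le a z : normc (a + z) <= normc a + normc z.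
Proof. exact: (@le_normcD R a z). Qed.

Lemma normc_opp a : normc (- a) = normc a.
Proof. exact: (@normcN R a). Qed.

Lemma ell2_add x y n : (x + y) n = x n + y n. Proof. by []. Qed.
Lemma ell2_opp x n : (- x) n = - x n. Proof. by []. Qed.
Lemma ell2_scale a x n : (a *: x) n = a * x n. Proof. by []. Qed.
Lemma ell2_zero n : (0 : ell2 R) n = 0. Proof. by []. Qed.

Lemma ell2_bigsum I (r : seq I) (P : pred I) (F : I -> ell2 R) n :
  (\sum_(i <- r | P i) F i) n = \sum_(i <- r | P i) F i n.
Proof. by elim/big_ind2 : _ => // [? y ? ? <- <-]. Qed.

Lemma ell2_eq x y : (forall n, x n = y n) -> x = y.
Proof. by move=> xy; apply: val_inj; apply/funext. Qed.

Lemma ell2_normrE x : `|x| = (ell2_rnorm x)%:C. Proof. by []. Qed.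

Lemma ell2_rnorm_ge0 x : 0 <= ell2_rnorm x. Proof. exact: sqrtr_ge0. Qed.
#[local] Hint Resolve ell2_rnorm_ge0 : core.

Lemma ell2_rnorm0 : ell2_rnorm (0 : ell2 R) = 0.
Proof. by have /(@complexI R) := @normr0 _ (ell2 R). Qed.

Lemma ell2_rnormN x : ell2_rnorm (- x) = ell2_rnorm x.
Proof. by have /(@complexI R) := @normrN _ _ x. Qed.

Lemma ell2_rnormZ a x : ell2_rnorm (a *: x) = normc a * ell2_rnorm x.
Proof. by apply: (@complexI R); rewrite rmorphM -ell2_normrE normrZ. Qed.

Lemma ell2_rnorm_sum (I : Type) (r : seq I) (P : pred I) (F : I -> ell2 R) :
  ell2_rnorm (\sum_(i <- r | P i) F i) <= \sum_(i <- r | P i) ell2_rnorm (F i).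
Proof.
elim/big_ind2 : _ => [|x a y b xa yb|//]; first by rewrite ell2_rnorm0.
exact: le_trans (ell2_rnormD _ _) (lerD xa yb).
Qed.

Lemma ell2_rnorm_coord x n : normc (x n) <= ell2_rnorm x.
Proof.
rewrite -ler_sqr ?nnegrE ?normcZ_ge0// -lee_fin -ell2_rnormE.
exact: ell2_sum_ge.
Qed.

Lemma ell2_rnorm_le x (c : R) : 0 <= c -> (ell2_sum x <= (c ^+ 2)%:E)%E ->
  ell2_rnorm x <= c.
Proof. by move=> c0; rewrite ell2_rnormE lee_fin ler_sqr ?nnegrE. Qed.

Definition disjoint_supp x y := forall n, x n = 0 \/ y n = 0.

Lemma ell2_pythagoras x y : disjoint_supp x y ->
  ell2_rnorm (x + y) ^+ 2 = ell2_rnorm x ^+ 2 + ell2_rnorm y ^+ 2.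
Proof.
move=> xy; apply: (@EFin_inj R); rewrite EFinD -!ell2_rnormE.
rewrite /ell2_sum -esumD; try by move=> n _; rewrite lee_fin sqr_ge0.
apply: eq_esum => n _; rewrite ell2_add -EFinD; congr EFin.
by case: (xy n) => ->; rewrite ?add0r ?addr0 normc0 expr0n ?add0r ?addr0.
Qed.

(** The form in which orthogonality enters: disjoint supports give it without
    a scalar product. *)
Lemma ell2_pythagoras_sum (u : nat -> ell2 R) m :
  (forall i j, (i < j)%N -> disjoint_supp (u i) (u j)) ->
  ell2_rnorm (\sum_(i < m) u i) ^+ 2 = \sum_(i < m) ell2_rnorm (u i) ^+ 2.
Proof.
move=> u_disj; elim: m => [|m IHm]; first by rewrite !big_ord0 ell2_rnorm0 expr0n.
rewrite !big_ord_recr/= ell2_pythagoras ?IHm// => n.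
have [um|um] := eqVneq (u m n) 0; [by right|left].
rewrite ell2_bigsum big1// => i _.
by case: (u_disj i m (ltn_ord i) n) => // um0; rewrite um0 eqxx in um.
Qed.

(** Stands in for completeness: a sequence given coordinatewise is square
    summable as soon as its finite windows extend to vectors of bounded norm. *)
Lemma ell2_fatou (x : int -> R[i]) (c : R) : 0 <= c ->
  (forall A : set int, finite_set A ->
     exists2 y : ell2 R, (forall n, A n -> x n = y n) & ell2_rnorm y <= c) ->
  (ell2_sum x <= (c ^+ 2)%:E)%E.
Proof.
move=> c0 H; apply: ge_ereal_sup => _ [A [finA _] <-].
have [y xy yc] := H _ finA.
apply: (@le_trans _ _ (ell2_sum y)); last first.
  by rewrite ell2_rnormE lee_fin ler_sqr ?nnegrE.
apply: esum_ge; exists A => //; rewrite le_eqVlt; apply/orP; left; apply/eqP.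
by apply: eq_fsbigr => n /set_mem An; rewrite xy.
Qed.

Lemma ell2_basis_supp n m : m != n -> ell2_basis R n m = 0.
Proof. by rewrite ell2_basisE => /negbTE ->. Qed.

Lemma ell2_rnorm_basis n : ell2_rnorm (ell2_basis R n) = 1.
Proof.
apply/eqP; rewrite -(@eqrXn2 _ 2)// ?ler01// -(inj_eq (@EFin_inj R)).
rewrite -ell2_rnormE /ell2_sum (esumID [set n])//; last first.
  by move=> m _; rewrite lee_fin sqr_ge0.
rewrite setTI esum_set1 ?lee_fin ?sqr_ge0// esum1 ?adde0.
  by rewrite ell2_basisE eqxx normc1.
by move=> m [_ /eqP mn]; rewrite ell2_basis_supp// normc0 expr0n.
Qed.

Lemma ell2_sum_basis (s : seq int) (f : int -> R[i]) n : uniq s ->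
  (\sum_(i <- s) f i *: ell2_basis R i) n = if n \in s then f n else 0.
Proof.
move=> us; rewrite ell2_bigsum; case: ifPn => ns.
  have i_n0 i : i != n -> (f i *: ell2_basis R i) n = 0.
    by rewrite ell2_scale eq_sym => /ell2_basis_supp ->; rewrite mulr0.
  rewrite (bigD1_seq n)//= big1// addr0.
  by rewrite -[LHS]/(f n * ell2_basis R n n) ell2_basisE eqxx mulr1.
rewrite big_seq big1// => i si; rewrite ell2_scale ell2_basisE.
by case: eqP => [ni|_]; [rewrite ni si in ns|rewrite mulr0].
Qed.

Lemma ell2_truncation x (e : R) : 0 < e -> exists s : seq int,
  uniq s /\ ell2_rnorm (x - \sum_(i <- s) x i *: ell2_basis R i) < e.
Proof.
move=> e0; have e2 : 0 < e ^+ 2 by rewrite exprn_gt0.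
have xfin : ell2_sum x \is a fin_num.
  by rewrite ell2_rnormE.
have [_ [A [finA _] <-] xA] := ub_ereal_sup_adherent e2 xfin.
move: xA; rewrite -[ereal_sup _]/(ell2_sum x) ell2_rnormE => xA.
have /finite_seqP[s As] := finA.
exists (undup s); split; first exact: undup_uniq.
set z := \sum_(i <- _) _; set y := x - z.
have zE n : z n = if n \in s then x n else 0.
  by rewrite ell2_sum_basis ?undup_uniq// mem_undup.
have yz : disjoint_supp y z.
  move=> n; rewrite ell2_add ell2_opp zE.
  by case: ifP => _; [left; rewrite subrr|right].
have := ell2_pythagoras yz; rewrite {1}/y subrK => xyz.
rewrite -ltr_sqr ?nnegrE ?(ltW e0)//.
have Az : (\sum_(i \in A) (normc (x i) ^+ 2)%:E <= (ell2_rnorm z ^+ 2)%:E)%E.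
  rewrite -ell2_rnormE; apply: esum_ge; exists A => //.
  rewrite le_eqVlt; apply/orP; left; apply/eqP.
  by apply: eq_fsbigr => n /set_mem; rewrite As /= zE => ->.
have := lt_le_trans xA Az; rewrite -EFinD lte_fin xyz; lra.
Qed.

End ell2_vectors.

(** * Weak neighbourhoods and almost orthogonal sequences *)

Section weak_topology.
Variable R : realType.
Notation dual := (topological_dual (ell2 R)).
Implicit Types (f : dual) (L : seq dual) (x y z : ell2 R).

Lemma dual_bounded f : exists2 M : R, 0 <= M &
  forall x, normc (sval f x) <= M * ell2_rnorm x.
Proof.
have /linear_bounded_continuous/linear_boundedP := svalP f.
move=> /pinfty_ex_gt0 [r r0 fr]; exists (normc r); first exact: normcZ_ge0.
have rE : r = (normc r)%:C by rewrite -[LHS]gtr0_norm.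
move=> x; have := fr x; rewrite {1}rE ell2_normrE -rmorphM.
by rewrite -[`|_|]/((normc _)%:C) lecR.
Qed.

(** The sublevel sets of these quadratic forms are a basis of weak
    neighbourhoods of [0].  Summing squares over the list lets Bessel's
    inequality treat finitely many functionals at once. *)
Definition gauge L z : R := \sum_(f <- L) normc (sval f z) ^+ 2.

Lemma gauge_ge0 L z : 0 <= gauge L z.
Proof. by apply: sumr_ge0 => f _; exact: sqr_ge0. Qed.

Lemma gauge_cat L1 L2 z : gauge (L1 ++ L2) z = gauge L1 z + gauge L2 z.
Proof. by rewrite /gauge big_cat. Qed.

Lemma normcD_sqr (a b : R[i]) :
  normc (a + b) ^+ 2 <= 2 * normc a ^+ 2 + 2 * normc b ^+ 2.
Proof.
have := normcD_le a b; have := normcZ_ge0 (a + b).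
move: (normc a) (normc b) (normc _) => p q r r0 rpq.
have pq0 : 0 <= p + q by exact: le_trans rpq.
have rpq2 : r ^+ 2 <= (p + q) ^+ 2 by rewrite ler_sqr.
apply: le_trans rpq2 _; rewrite -subr_ge0.
by rewrite (_ : _ - _ = (p - q) ^+ 2) ?sqr_ge0//; ring.
Qed.

Lemma gaugeD L x y : gauge L (x + y) <= 2 * gauge L x + 2 * gauge L y.
Proof.
rewrite /gauge !mulr_sumr -big_split/=; apply: ler_sum => f _.
rewrite raddfD; exact: normcD_sqr.
Qed.

Lemma gauge_bounded L : exists2 K : R, 0 < K &
  forall z, gauge L z <= K * ell2_rnorm z ^+ 2.
Proof.
rewrite /gauge; elim: L => [|f L [K K0 LK]].
  by exists 1 => // z; rewrite big_nil mul1r sqr_ge0.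
have [M M0 fM] := dual_bounded f.
exists (M ^+ 2 + K) => [|z]; first by rewrite ltr_wpDl ?sqr_ge0.
rewrite big_cons mulrDl lerD// -exprMn.
by rewrite ler_sqr ?nnegrE ?mulr_ge0 ?normcZ_ge0 ?ell2_rnorm_ge0 ?fM.
Qed.

Lemma sqr_normc_conj (a : R[i]) : a^*%C * a = (normc a ^+ 2)%:C.
Proof. by rewrite mulrC -sqr_normc rmorphXn. Qed.

Lemma normc_conj (a : R[i]) : normc a^*%C = normc a.
Proof. by apply: (@complexI R); exact: (normcJ a). Qed.

(** Bessel's inequality without representing [f] by a vector: test [f] on
    [v = sum_i (f (u i))^* / c i *: u i], for which [f v = B] is the sum to be
    bounded and [|v|^2 <= B], and compare with [|f v| <= M |v|]. *)
Lemma dual_bessel f : exists K : R, forall (u : nat -> ell2 R) (c : nat -> R),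
  (forall i j, (i < j)%N -> disjoint_supp (u i) (u j)) ->
  (forall i, 0 < c i) -> (forall i, ell2_rnorm (u i) ^+ 2 <= c i) ->
  forall m, \sum_(i < m) normc (sval f (u i)) ^+ 2 / c i <= K.
Proof.
have [M M0 fM] := dual_bounded f; exists (M ^+ 2) => u c u_disj c0 uc m.
set B := \sum_(i < m) _.
have B0 : 0 <= B.
  by apply: sumr_ge0 => i _; rewrite mulr_ge0 ?sqr_ge0// invr_ge0 ltW.
pose a i : R[i] := (sval f (u i))^*%C * ((c i)^-1)%:C.
pose v := \sum_(i < m) a i *: u i.
have fv : sval f v = B%:C.
  rewrite raddf_sum rmorph_sum; apply: eq_bigr => i _ /=.
  rewrite linearZ -[LHS]/(a i * sval f (u i)) /a mulrAC.
  by rewrite sqr_normc_conj -rmorphM.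
have vB : ell2_rnorm v ^+ 2 <= B.
  rewrite (@ell2_pythagoras_sum R (fun i => a i *: u i)); last first.
    move=> i j /u_disj dij n; rewrite !ell2_scale.
    by case: (dij n) => ->; [left|right]; rewrite mulr0.
  apply: ler_sum => i _; rewrite ell2_rnormZ exprMn /a normcM normc_conj normc_complex.
  have ci0 : 0 < (c i)^-1 by rewrite invr_gt0.
  rewrite gtr0_norm// exprMn -mulrA ler_wpM2l ?sqr_ge0//.
  rewrite [(_^-1) ^+ 2]expr2 -mulrA ler_piMr ?(ltW ci0)//.
  by rewrite mulrC ler_pdivrMr// mul1r.
have := fM v; rewrite fv normc_complex ger0_norm// => BMv.
have [->|Bn0] := eqVneq B 0; first exact: sqr_ge0.
have Bp : 0 < B by rewrite lt_def Bn0.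
rewrite -(ler_pM2r Bp) -expr2; apply: (@le_trans _ _ ((M * ell2_rnorm v) ^+ 2)).
  by rewrite ler_sqr ?nnegrE ?mulr_ge0 ?ell2_rnorm_ge0 ?(ltW Bp).
by rewrite exprMn ler_wpM2l ?sqr_ge0.
Qed.

Lemma gauge_bessel L : exists K : R, forall (u : nat -> ell2 R) (c : nat -> R),
  (forall i j, (i < j)%N -> disjoint_supp (u i) (u j)) ->
  (forall i, 0 < c i) -> (forall i, ell2_rnorm (u i) ^+ 2 <= c i) ->
  forall m, \sum_(i < m) gauge L (u i) / c i <= K.
Proof.
elim: L => [|f L [K LK]].
  exists 0 => u c _ _ _ m; rewrite big1// => i _.
  by rewrite /gauge big_nil mul0r.
have [M fM] := dual_bessel f; exists (M + K) => u c u_disj c0 uc m.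
have := lerD (fM u c u_disj c0 uc m) (LK u c u_disj c0 uc m).
rewrite -big_split/=; congr (_ <= _); apply: eq_bigr => i _.
by rewrite /gauge big_cons mulrDl.
Qed.

(** Norms growing like the square root of the index are the borderline case:
    Bessel's inequality would bound the harmonic series if the gauge stayed
    above [e]. *)
Lemma gauge_small_along L (u : nat -> ell2 R) (C e : R) N :
  (forall i j, (i < j)%N -> disjoint_supp (u i) (u j)) ->
  (forall i, ell2_rnorm (u i) ^+ 2 <= C * i.+1%:R) -> 0 < e ->
  exists2 t, (N <= t)%N & gauge L (u t) < e.
Proof.
move=> u_disj uC e0; apply: contrapT => noT.
have uLe t : (N <= t)%N -> e <= gauge L (u t).
  by move=> Nt; rewrite leNgt; apply/negP => ute; apply: noT; exists t.
have [K LK] := gauge_bessel L.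
pose D := (`|C| + 1) * N.+1%:R.
have D0 : 0 < D by rewrite mulr_gt0// ltr_wpDl.
have {}LK m : \sum_(i < m) e / D / i.+1%:R <= K.
  have c0 i : 0 < D * i.+1%:R by rewrite mulr_gt0.
  have uD i : ell2_rnorm (u (i + N)%N) ^+ 2 <= D * i.+1%:R.
    apply: le_trans (uC _) _; rewrite /D -mulrA -natrM.
    apply: (@le_trans _ _ ((`|C| + 1) * (i + N).+1%:R)).
      by rewrite ler_wpM2r//; have := ler_norm C; lra.
    by rewrite ler_wpM2l ?addr_ge0// ler_nat; lia.
  have dN i j : (i < j)%N -> disjoint_supp (u (i + N)%N) (u (j + N)%N).
    by move=> ij; apply: u_disj; rewrite ltn_add2r.
  apply: le_trans (LK (fun i => u (i + N)%N) _ dN c0 uD m).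
  apply: ler_sum => i _; rewrite -mulrA -invfM ler_wpM2r ?uLe ?leq_addl//.
  by rewrite invr_ge0 ltW.
apply: (@dvg_harmonic R); apply: nondecreasing_is_cvgn.
  by apply: nondecreasing_series => n _ _; exact: harmonic_ge0.
exists (K / (e / D)) => _ [m _ <-].
rewrite ler_pdivlMr ?divr_gt0// mulrC mulr_sumr.
by rewrite big_mkord; exact: LK.
Qed.

(** The sets containing a gauge ball around [y] form a filter that converges to
    [y] for each initial topology, hence for their supremum; so every weak
    neighbourhood of [y] belongs to it. *)
Lemma weak_nbhs_gauge (O : set (weak_space (ell2 R))) y : open O -> O y ->
  exists L, exists2 e : R, 0 < e & forall z, gauge L (z - y) < e -> O z.
Proof.
move=> oO Oy.
pose F : set_system (ell2 R) := [set E : set (ell2 R) | exists L, exists2 e : R,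
  0 < e & forall z, gauge L (z - y) < e -> E z].
have FF : Filter F.
  split=> [|A B [L1 [e1 e10 A1]] [L2 [e2 e20 B2]]|A B AB [L [e e0 A1]]].
  - by exists [::]; exists 1.
  - exists (L1 ++ L2); exists (Order.min e1 e2); first by rewrite lt_min e10.
    move=> z; rewrite gauge_cat lt_min => /andP[z1 z2]; split.
      by apply: A1; apply: le_lt_trans z1; rewrite lerDl gauge_ge0.
    by apply: B2; apply: le_lt_trans z2; rewrite lerDr gauge_ge0.
  - by exists L; exists e => // z /A1/AB.
have : F --> (y : weak_space (ell2 R)).
  apply/cvg_sup => f A.
  rewrite nbhsE => -[_ [[U oU <-] Uy] UA].
  have : nbhs (sval f y : R[i]^o) U by exact: open_nbhs_nbhs.
  move=> /nbhs_normP [e /= e0 eU].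
  have er : e = (normc e)%:C by rewrite -[LHS]ger0_norm ?ltW.
  have ne0 : 0 < normc e by rewrite -ltcR -er.
  exists [:: f]; exists (normc e ^+ 2); first by rewrite exprn_gt0.
  move=> z; rewrite /gauge big_seq1 ltr_sqr ?nnegrE ?normcZ_ge0// => fz.
  apply: UA; apply: eU => /=; rewrite er -normrN opprB -raddfB.
  by rewrite -[`|_|]/((normc _)%:C) ltcR.
by apply; exact: open_nbhs_nbhs.
Qed.

End weak_topology.

(** * Weighted translations and weighted shifts *)

Section weighted_translation.
Variable R : realType.

(** The shifts and the placement of a target inside a vector are both
    translations followed by a diagonal operator. *)
Definition wtrans_fun (c : int -> R) (d : int) (x : int -> R[i]) : int -> R[i] :=
  fun i => (c i)%:C * x (i + d).

Lemma ell2_sum_translate (x : int -> R[i]) (d : int) :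
  ell2_sum (fun i => x (i + d)) = ell2_sum x.
Proof.
rewrite /ell2_sum.
rewrite (@reindex_esum R _ _ setT setT (fun i : int => i + d)
  (fun i => (normc (x i) ^+ 2)%:E))//.
split=> [//|i j _ _ /addIr//|j _ /=].
by exists (j - d) => //; rewrite subrK.
Qed.

Lemma ell2_sum_wtrans_le (c : int -> R) (d : int) (x : int -> R[i]) (C : R) :
  0 <= C -> (forall i, x (i + d) != 0 -> `|c i| <= C) ->
  (ell2_sum (wtrans_fun c d x) <= (C ^+ 2)%:E * ell2_sum x)%E.
Proof.
move=> C0 cC; rewrite -(ell2_sum_translate x d) /ell2_sum -esumZl_fin ?sqr_ge0//.
  apply: le_esum => i _; rewrite lee_fin -exprMn.
  rewrite ler_sqr ?nnegrE ?mulr_ge0 ?normcZ_ge0//.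
  rewrite [normc _]normcM normc_complex.
  have [->|/cC ci] := eqVneq (x (i + d)) 0; first by rewrite normc0 !mulr0.
  by rewrite ler_wpM2r ?normcZ_ge0.
by move=> i; exact: sqr_ge0.
Qed.

Variables (c : int -> R) (C : R) (cC : forall i, `|c i| <= C) (d : int).

Lemma wtrans_subproof (x : ell2 R) : wtrans_fun c d x \in @ell2_pred R.
Proof.
have C0 : 0 <= C := le_trans (normr_ge0 _) (cC 0).
rewrite unfold_in (le_lt_trans (ell2_sum_wtrans_le C0 _))//.
by rewrite ell2_rnormE -EFinM ltry.
Qed.

Definition wtrans (x : ell2 R) : ell2 R := Ell2 (wtrans_subproof x).

Lemma wtransE x i : wtrans x i = (c i)%:C * x (i + d).
Proof. by []. Qed.

Lemma wtrans_linear : linear wtrans.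
Proof.
move=> a x y; apply: ell2_eq => i.
by rewrite ell2_add ell2_scale !wtransE ell2_add ell2_scale mulrDr mulrCA.
Qed.

HB.instance Definition _ :=
  GRing.isLinear.Build R[i] (ell2 R) (ell2 R) *:%R wtrans wtrans_linear.

(** The coefficients matter only where the translated vector lives: this is how
    a small weight on the support of a target makes its copy small. *)
Lemma rnorm_wtrans_le (x : ell2 R) (K : R) :
  0 <= K -> (forall i, x (i + d) != 0 -> `|c i| <= K) ->
  ell2_rnorm (wtrans x) <= K * ell2_rnorm x.
Proof.
move=> K0 cK; apply: ell2_rnorm_le; first by rewrite mulr_ge0 ?ell2_rnorm_ge0.
rewrite exprMn EFinM -ell2_rnormE; exact: (ell2_sum_wtrans_le K0 cK).
Qed.

Lemma wtrans_bounded (x : ell2 R) : ell2_rnorm (wtrans x) <= C * ell2_rnorm x.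
Proof. by apply: rnorm_wtrans_le => //; exact: le_trans (normr_ge0 _) (cC 0). Qed.

End weighted_translation.

(** The exponent of the weights.  The Lipschitz condition is what bounds the
    shifts [wshift d] for both signs of [d]. *)
Record lipweight := Lipweight {
  lipfun :> int -> nat;
  lipP : forall i d : int, (lipfun (i + d) <= lipfun i + `|d|)%N }.

Section weighted_shift.
Variables (R : realType) (h : lipweight).
Implicit Types (x F : ell2 R) (d m i : int).

Definition gam i : R := (2 ^+ h i)^-1.

Lemma gam_gt0 i : 0 < gam i.
Proof. by rewrite invr_gt0 exprn_gt0. Qed.

Lemma gam_le1 i : `|gam i| <= 1.
Proof.
by rewrite gtr0_norm ?gam_gt0// invf_le1 ?exprn_gt0// exprn_ege1// ler1n.
Qed.

Lemma gam_le i n : (n <= h i)%N -> gam i <= (2 ^+ n)^-1.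
Proof.
by move=> nh; rewrite lef_pV2 ?posrE ?exprn_gt0// ler_weXn2l// ler1n.
Qed.

Lemma gam_ge i n : (h i <= n)%N -> (2 ^+ n)^-1 <= gam i.
Proof.
by move=> nh; rewrite lef_pV2 ?posrE ?exprn_gt0// ler_weXn2l// ler1n.
Qed.

Lemma gam_ratio d i : `|gam i / gam (i + d)| <= 2 ^+ `|d|%N.
Proof.
rewrite gtr0_norm ?divr_gt0 ?gam_gt0// /gam invrK mulrC.
rewrite ler_pdivrMr ?exprn_gt0// -exprD ler_weXn2l ?ler1n//.
by rewrite addnC; exact: lipP.
Qed.

Definition wshift d : ell2 R -> ell2 R := wtrans (@gam_ratio d) d.
HB.instance Definition _ d := GRing.Linear.on (wshift d).

(** [wpatch m F] is the vector whose quotient by [gam] is [F] translated by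
    [- m]; shifts act on such vectors by mere translation, see
    [wshift_wpatch]. *)
Definition wpatch m : ell2 R -> ell2 R := wtrans gam_le1 m.
HB.instance Definition _ m := GRing.Linear.on (wpatch m).

Lemma wshiftE d x i : wshift d x i = (gam i / gam (i + d))%:C * x (i + d).
Proof. by []. Qed.

Lemma wpatchE m F i : wpatch m F i = (gam i)%:C * F (i + m).
Proof. by []. Qed.

Lemma wshift_bounded d x : ell2_rnorm (wshift d x) <= 2 ^+ `|d|%N * ell2_rnorm x.
Proof. exact: wtrans_bounded. Qed.

Lemma wpatch_contraction m F : ell2_rnorm (wpatch m F) <= ell2_rnorm F.
Proof. by rewrite -[leRHS]mul1r; exact: wtrans_bounded. Qed.

Lemma wpatch_small m F n : (forall i, F (i + m) != 0 -> (n <= h i)%N) ->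
  ell2_rnorm (wpatch m F) <= (2 ^+ n)^-1 * ell2_rnorm F.
Proof.
move=> Fn; apply: rnorm_wtrans_le => [|i /Fn ni]; first by rewrite invr_ge0 exprn_ge0.
by rewrite gtr0_norm ?gam_gt0// gam_le.
Qed.

Lemma wshiftD d m x : wshift d (wshift m x) = wshift (d + m) x.
Proof.
apply: ell2_eq => i; rewrite !wshiftE mulrA -rmorphM addrA; congr (_%:C * _).
by rewrite mulrA divfK// gt_eqF ?gam_gt0.
Qed.

Lemma wshift0 x : wshift 0 x = x.
Proof.
by apply: ell2_eq => i; rewrite wshiftE addr0 divff ?mul1r// gt_eqF ?gam_gt0.
Qed.

Lemma wshift_wpatch d m F : wshift d (wpatch m F) = wpatch (m + d) F.
Proof.
apply: ell2_eq => i; rewrite wshiftE !wpatchE mulrA -rmorphM divfK.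
  by rewrite -addrA [d + m]addrC.
by rewrite gt_eqF ?gam_gt0.
Qed.

Lemma iter_wshift d x n : iter n (wshift d) x = wshift (d * n%:Z) x.
Proof.
elim: n => [|n IHn]; first by rewrite mulr0 wshift0.
by rewrite iterS IHn wshiftD -addn1 PoszD mulrDr mulr1 addrC.
Qed.

Lemma wshiftK d : cancel (wshift d) (wshift (- d)).
Proof. by move=> x; rewrite wshiftD addNr wshift0. Qed.

Lemma wshiftNK d : cancel (wshift (- d)) (wshift d).
Proof. by move=> x; rewrite wshiftD addrN wshift0. Qed.

Lemma wshift_basis d n : wshift d (ell2_basis R n) =
  (gam (n - d) / gam n)%:C *: ell2_basis R (n - d).
Proof.
apply: ell2_eq => i; rewrite wshiftE ell2_scale !ell2_basisE.
rewrite -(inj_eq (addIr d) i (n - d)) subrK.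
by have [<-|_] := eqVneq (i + d) n; rewrite ?mulr0// addrK.
Qed.

Lemma wshift_bounded_operator d : bounded_operator (wshift d).
Proof.
exists ((2 ^+ `|d|%N)%:C) => x; rewrite !ell2_normrE -rmorphM lecR.
exact: wshift_bounded.
Qed.

Lemma wshift1_bilateral : bilateral_weighted_shift (wshift 1).
Proof.
exists (fun n => (gam (n - 1) / gam n)%:C); split.
- exists ((2 : R)%:C); split; first by rewrite /= realE lecR ler0n.
  move=> M M2 n _ /=; apply: ltW; apply: le_lt_trans M2.
  rewrite -[`|_|]/((normc _)%:C) lecR normc_complex.
  by have := gam_ratio 1 (n - 1); rewrite subrK expr1.
- move=> n; rewrite (inj_eq (@complexI R)) mulf_neq0 ?invr_eq0//;
    by rewrite gt_eqF ?gam_gt0.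
- exact: wshift_bounded_operator.
- exact: wshift_basis.
Qed.

End weighted_shift.

(** * Shifts that are not hypercyclic *)

Lemma dense_orbit_ball (R : realType) (T : ell2 R -> ell2 R) (x y : ell2 R) (e : R) :
  dense (Defs.orbit T x) -> 0 < e -> exists n, ell2_rnorm (iter n T x - y) < e.
Proof.
move=> xd e0; have ec0 : 0 < e%:C by rewrite ltcR.
have [|z [yz [n _ nz]]] := xd (ball y e%:C) _ (ball_open _ _).
  by exists y; exact: ballxx.
exists n; rewrite nz -ltcR -ell2_normrE -normrN opprB.
by move: yz; rewrite -ball_normE.
Qed.

(** A hypercyclic [x] has [x p != 0] for some [p >= 0].  The vector
    [t *: e_0], with [t] beyond both [|x|] and the coordinate [0] of [T^p x],
    cannot be approached within [d]: see the coordinates [0] and [p - n]. *)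
Lemma wshift_not_hypercyclic (R : realType) (h : lipweight) :
  (forall n : nat, h n%:Z = 0%N \/ h (- n%:Z) = 0%N) ->
  ~ hypercyclic (@wshift R h 1).
Proof.
move=> h0 [x xd]; set T := @wshift R h 1.
have gam1 i : h i = 0%N -> gam R h i = 1 by rewrite /gam => ->; rewrite expr0 invr1.
have g0 : gam R h 0 = 1 by apply: gam1; have [] := h0 0%N; rewrite ?oppr0.
have TE n i : iter n T x i = (gam R h i / gam R h (i + n%:Z))%:C * x (i + n%:Z).
  by rewrite iter_wshift mul1r wshiftE.
have [p] := dense_orbit_ball (ell2_basis R 0) xd ltr01.
move=> /(le_lt_trans (ell2_rnorm_coord _ 0)).
rewrite ell2_add ell2_opp ell2_basisE eqxx => px1.
have xp0 : x p%:Z != 0.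
  apply: contraTneq px1; rewrite TE add0r => ->.
  by rewrite mulr0 add0r normc_opp normc1 ltxx.
have nxp : 0 < normc (x p%:Z).
  by rewrite lt_def normcZ_ge0 andbT; apply: contra_neq xp0 => /eq0_normc.
(* 2 ^- p bounds the loss from gam (- n) to gam (p - n). *)
pose d := Order.min 1 ((2 ^+ p)^-1 * normc (x p%:Z)).
have d0 : 0 < d by rewrite lt_min ltr01 mulr_gt0// invr_gt0 exprn_gt0.
pose t := ell2_rnorm x + normc (iter p T x 0) + 1.
have [n nd] := dense_orbit_ball (t%:C *: ell2_basis R 0) xd d0.
have nd1 : ell2_rnorm (iter n T x - t%:C *: ell2_basis R 0) < 1.
  by apply: lt_le_trans nd _; rewrite ge_min lexx.
have t0 : 0 <= t by rewrite !addr_ge0 ?ell2_rnorm_ge0 ?normcZ_ge0.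
have nt : t - 1 < normc (iter n T x 0).
  have := le_lt_trans (ell2_rnorm_coord _ 0) nd1.
  rewrite ell2_add ell2_opp ell2_scale ell2_basisE eqxx mulr1.
  set z := iter n T x 0 => zt.
  have := normcD_le (t%:C - z) z; rewrite subrK normc_complex ger0_norm//.
  rewrite -[normc (_ - z)]normc_opp opprB => tz; lra.
(* For n = p the coordinate p - n would be the one carrying the target. *)
have np : n != p.
  apply: contraTneq nt => ->; rewrite -leNgt /t addrK lerDr.
  exact: ell2_rnorm_ge0.
have [hn|hn] := h0 n.
  move: nt; rewrite TE add0r g0 (gam1 _ hn) divr1 mul1r.
  have := ell2_rnorm_coord x n%:Z; have := normcZ_ge0 (iter p T x 0).
  rewrite /t; lra.
have := le_lt_trans (ell2_rnorm_coord _ (p%:Z - n%:Z)) nd.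
rewrite ell2_add ell2_opp ell2_scale ell2_basisE TE subrK subr_eq0.
rewrite eqz_nat eq_sym (negbTE np) mulr0 subr0 normcM normc_complex.
have gp : (2 ^+ p)^-1 <= gam R h (p%:Z - n%:Z).
  by apply: gam_ge; have := lipP h (- n%:Z) p; rewrite hn addrC.
apply/negP; rewrite -leNgt ge_min; apply/orP; right.
rewrite ler_wpM2r ?normcZ_ge0// gtr0_norm ?divr_gt0 ?gam_gt0//.
apply: le_trans gp _; rewrite ler_pdivlMr ?gam_gt0// ler_piMr ?(ltW (gam_gt0 _ _ _))//.
exact: le_trans (ler_norm _) (gam_le1 _ _ _).
Qed.

(** * A schedule of finitely supported targets *)

Lemma logn2_fact_leq n : (logn 2 n`! <= n)%N.
Proof.
rewrite logn_fact// big_add1 /=.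
suff : forall T, (\sum_(0 <= k < T) n %/ 2 ^ k.+1 + n %/ 2 ^ T <= n)%N.
  by move=> /(_ n); apply: leq_trans; exact: leq_addr.
elim=> [|T IHT]; first by rewrite big_geq// expn0 divn1.
apply: leq_trans IHT; rewrite big_nat_recr//= -addnA leq_add2l.
rewrite expnSr divnMA; lia.
Qed.

Lemma sum_logn2_leq n : (\sum_(j < n) logn 2 j.+1 <= n)%N.
Proof.
apply: leq_trans (logn2_fact_leq n); rewrite eq_leq//.
elim: n => [|n IHn]; first by rewrite big_ord0.
by rewrite big_ord_recr/= IHn factS lognM ?fact_gt0// addnC.
Qed.

Lemma logn2_leq n : (logn 2 n.+1 <= n)%N.
Proof.
rewrite -ltnS; apply: leq_trans (dvdn_leq _ (pfactor_dvdnn 2 n.+1)) => //.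
exact: ltn_expl.
Qed.

Lemma logn2_odd_mul m t : logn 2 (2 ^ m * t.*2.+1) = m.
Proof.
by rewrite lognM ?expn_gt0// pfactorK// lognE/= dvdn2/= odd_double addn0.
Qed.

Section targets.
Variables (R : realType) (h : lipweight).

Definition gauss (c : rat * rat) : R[i] := (ratr c.1 +i* ratr c.2)%C.

(** The coefficients are divided by [gam] so that [wpatch h 0], which multiplies
    by [gam], returns finite combinations with Gaussian rational coefficients. *)
Definition target (s : seq (int * (rat * rat))) : ell2 R :=
  \sum_(a <- s) (gauss a.2 * ((gam R h a.1)^-1)%:C) *: ell2_basis R a.1.

Lemma target_supp s : exists B, forall i, target s i != 0 -> (`|i| <= B)%N.
Proof.
elim: s => [|a s [B sB]].
  by exists 0%N => i; rewrite /target big_nil ell2_zero eqxx.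
exists (maxn `|a.1| B) => i; rewrite /target big_cons.
have [->|ia] := eqVneq i a.1; first by rewrite leq_maxl.
rewrite ell2_add ell2_scale ell2_basis_supp// mulr0 add0r => /sB iB.
by rewrite leq_max iB orbT.
Qed.

Lemma wpatch0_target s :
  wpatch h 0 (target s) = \sum_(a <- s) gauss a.2 *: ell2_basis R a.1.
Proof.
rewrite /target raddf_sum; apply: eq_bigr => a _; apply: ell2_eq => i.
rewrite wpatchE addr0 !ell2_scale ell2_basisE.
have [->|_] := eqVneq i a.1; last by rewrite !mulr0.
by rewrite !mulr1 mulrCA -rmorphM divff ?mulr1// gt_eqF ?gam_gt0.
Qed.

Lemma normc_le_ReIm (z : R[i]) : normc z <= `|complex.Re z| + `|complex.Im z|.
Proof.
case: z => a b /=; rewrite -ler_sqr ?nnegrE ?sqrtr_ge0 ?addr_ge0//.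
rewrite sqr_sqrtr ?addr_ge0 ?sqr_ge0//.
rewrite -(real_normK (num_real a)) -(real_normK (num_real b)) sqrrD addrAC.
by rewrite lerDl mulrn_wge0// mulr_ge0.
Qed.

Lemma rat_approx (r e : R) : 0 < e -> exists q : rat, `|ratr q - r| < e.
Proof.
move=> e0; have re : r - e < r + e by lra.
have [q] := rat_in_itvoo re; rewrite in_itv/= => /andP[q1 q2].
by exists q; rewrite ltr_norml; apply/andP; split; lra.
Qed.

Lemma gauss_approx (z : R[i]) (e : R) : 0 < e -> exists c, normc (gauss c - z) < e.
Proof.
move=> e0; have e2 : 0 < e / 2 by lra.
have [p pz] := rat_approx (complex.Re z) e2; have [q qz] := rat_approx (complex.Im z) e2.
exists (p, q); apply: le_lt_trans (normc_le_ReIm _) _.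
case: z pz qz => a b /= pz qz; lra.
Qed.

Lemma target_dense (x : ell2 R) (e : R) : 0 < e ->
  exists s, ell2_rnorm (wpatch h 0 (target s) - x) < e.
Proof.
move=> e0; have e2 : 0 < e / 2 by lra.
have [l [_ xl]] := ell2_truncation x e2.
suff [s sl] : exists s, ell2_rnorm
    (wpatch h 0 (target s) - \sum_(i <- l) x i *: ell2_basis R i) < e / 2.
  exists s; rewrite -(subrKA (\sum_(i <- l) x i *: ell2_basis R i)).
  apply: le_lt_trans (ell2_rnormD _ _) _.
  by rewrite -[ell2_rnorm (_ - x)]ell2_rnormN opprB; lra.
elim: l (e / 2) e2 {xl} => [|i l IHl] d d0.
  by exists [::]; rewrite wpatch0_target !big_nil subrr ell2_rnorm0.
have d2 : 0 < d / 2 by lra.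
have [s sl] := IHl _ d2; have [c cx] := gauss_approx (x i) d2.
exists ((i, c) :: s); move: sl; rewrite !wpatch0_target !big_cons/=.
move: (\sum_(a <- s) _) (\sum_(a <- l) _) => u v uv.
rewrite opprD addrACA -scalerBl; apply: le_lt_trans (ell2_rnormD _ _) _.
by rewrite ell2_rnormZ ell2_rnorm_basis mulr1; lra.
Qed.

(** At time [j] the level is [logn 2 j.+1].  Level [m] shows target number
    [logn 2 m], so each target has infinitely many levels, and a target is
    admitted only at levels large enough to bound its support and its squared
    norm.  The sum of the first [k] squared norms is then at most
    [k + logn 2 k`!], hence at most [2 * k], and level [m] recurs exactly at the
    odd multiples of [2 ^ m]. *)
Lemma exists_target_schedule : exists y : nat -> ell2 R,
  [/\ forall j i, y j i != 0 -> (`|i| <= j)%N,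
      forall j, ell2_rnorm (y j) ^+ 2 <= j.+1%:R,
      forall k, \sum_(j < k) ell2_rnorm (y j) ^+ 2 <= (2 * k)%:R &
      forall (x : ell2 R) (e : R), 0 < e -> exists2 a : nat, (0 < a)%N &
        forall t, ell2_rnorm (wpatch h 0 (y (a * t.*2.+1).-1) - x) < e].
Proof.
pose G n := target (odflt [::] (unpickle n)).
pose ok m (F : ell2 R) := (forall i, F i != 0 -> (`|i| <= m)%N) /\
  ell2_rnorm F ^+ 2 <= m.+1%:R.
pose d m := if `[< ok m (G (logn 2 m)) >] then G (logn 2 m) else 0.
have d_ok m : ok m (d m).
  rewrite /d; case: ifPn => [/asboolP//|_]; split; first by move=> i; rewrite eqxx.
  by rewrite ell2_rnorm0 expr0n.
exists (fun j => d (logn 2 j.+1)); split.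
- move=> j i /(proj1 (d_ok _) i)/leq_trans; apply; exact: logn2_leq.
- move=> j; apply: le_trans (proj2 (d_ok _)) _.
  by rewrite ler_nat ltnS logn2_leq.
- move=> k; apply: (@le_trans _ _ (\sum_(j < k) (logn 2 j.+1).+1%:R)).
    by apply: ler_sum => j _; exact: (proj2 (d_ok _)).
  rewrite -natr_sum ler_nat; under eq_bigr do rewrite -addn1.
  rewrite big_split/= sum1_card card_ord mul2n -addnn leq_add2r.
  exact: sum_logn2_leq.
- move=> x e /(target_dense x) [s sx]; set n := pickle s.
  have Gn : G n = target s by rewrite /G pickleK.
  have [B sB] := target_supp s.
  pose r := (ell2_rnorm (target s)) ^+ 2.
  have r0 : 0 <= r by exact: sqr_ge0.
  pose t := (B + Num.bound r)%N; pose m := (2 ^ n * t.*2.+1)%N.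
  have tm : (t <= m)%N.
    apply: (@leq_trans t.*2.+1); first by rewrite -addnn; lia.
    by rewrite leq_pmull// expn_gt0.
  have dm : d m = target s.
    rewrite /d logn2_odd_mul Gn; case: asboolP => // -[]; split.
      by move=> i /sB/leq_trans; apply; apply: leq_trans tm; exact: leq_addr.
    apply: ltW; apply: lt_le_trans (archi_boundP r0) _.
    by rewrite ler_nat ltnW// ltnS; apply: leq_trans tm; exact: leq_addl.
  (* m is a level of target n that bounds its support and squared norm. *)
  exists (2 ^ m)%N; first by rewrite expn_gt0.
  move=> k; rewrite prednK ?muln_gt0 ?expn_gt0// logn2_odd_mul dm//.
Qed.

End targets.

(** * A criterion for weak hypercyclicity *)

Lemma sum_geo_le (R : realFieldType) N K :
  \sum_(N.+1 <= j < K) (2 ^+ j)^-1 <= (2 ^+ N)^-1 :> R.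
Proof.
have [KN|NK] := leqP K N.+1; first by rewrite big_geq ?invr_ge0 ?exprn_ge0.
suff : forall n, \sum_(N.+1 <= j < N.+1 + n) (2 ^+ j)^-1 =
    (2 ^+ N)^-1 - (2 ^+ (N + n))^-1 :> R.
  move=> /(_ (K - N.+1)%N); rewrite subnKC ?(ltnW NK)// => ->.
  by rewrite gerBl invr_ge0 exprn_ge0.
elim=> [|n IHn]; first by rewrite !addn0 big_geq// subrr.
rewrite addnS big_nat_recr ?leq_addr//= IHn addSn addnS exprS invfM.
by field; rewrite !expf_neq0 ?pnatr_eq0.
Qed.

Lemma finite_set_int_bound (A : set int) : finite_set A ->
  exists M, forall i, A i -> (`|i| < M)%N.
Proof.
move=> /finite_seqP[s ->]; exists (\max_(i <- s) `|i|%N).+1 => i si.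
by rewrite ltnS; exact: (leq_bigmax_seq i (F := fun i : int => `|i|%N)).
Qed.

(** A series of vectors whose [j]-th term vanishes on [-j < i < j] has a
    coordinatewise sum; bounds on its partial sums pass to this sum and to its
    tails. *)
Section locally_finite_series.
Variables (R : realType) (p : nat -> ell2 R).
Hypothesis p_loc : forall j i, (`|i| < j)%N -> p j i = 0.

Let f (i : int) : R[i] := (\sum_(j < `|i|.+1) p j) i.

Let fE i K : (`|i| < K)%N -> f i = (\sum_(0 <= j < K) p j) i.
Proof.
move=> iK; have -> : \sum_(0 <= j < K) p j =
    \sum_(0 <= j < `|i|.+1) p j + \sum_(`|i|.+1 <= j < K) p j.
  by rewrite -big_cat_nat.
rewrite ell2_add [X in _ + X]ell2_bigsum [X in _ + X]big_nat.
rewrite [X in _ + X]big1 ?addr0 ?big_mkord// => j /andP[ij _]; exact: p_loc.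
Qed.

Lemma locally_finite_series (c0 : R) : 0 <= c0 ->
  (forall K, ell2_rnorm (\sum_(0 <= j < K) p j) <= c0) ->
  exists x : ell2 R, forall N c, 0 <= c ->
    (forall K, ell2_rnorm (\sum_(N <= j < K) p j) <= c) ->
    ell2_rnorm (x - \sum_(0 <= j < N) p j) <= c.
Proof.
move=> c00 pc0.
have fP : f \in @ell2_pred R.
  rewrite unfold_in; apply: (@le_lt_trans _ _ (c0 ^+ 2)%:E); last exact: ltry.
  apply: ell2_fatou => // A /finite_set_int_bound[M AM].
  by exists (\sum_(0 <= j < M) p j) => // i /AM /fE.
exists (Ell2 fP) => N c cp pc; apply: ell2_rnorm_le => //.
apply: ell2_fatou => // A /finite_set_int_bound[M AM].
exists (\sum_(N <= j < maxn N M) p j) => // i /AM iM.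
rewrite ell2_add ell2_opp -[Ell2 fP i]/(f i) (@fE _ (maxn N M)); last first.
  by rewrite (leq_trans iM)// leq_maxr.
have -> : \sum_(0 <= j < maxn N M) p j =
    \sum_(0 <= j < N) p j + \sum_(N <= j < maxn N M) p j.
  by rewrite -big_cat_nat// leq_maxl.
by rewrite ell2_add addrAC subrr add0r.
Qed.

End locally_finite_series.

(** [m] lists the signed positions of the copies.  [m_separated] makes the
    earlier copies pairwise disjoint, within one time [k] and between two times
    [k] and [k']; [h_large] makes copy [j] so small that it stays small after
    the expansion, by at most [2 ^ |m k|], that the shift by [m k] causes. *)
Section weak_hypercyclicity.
Variables (R : realType) (h : lipweight) (m : nat -> int).
Hypothesis m_large : forall j, (2 * j <= `|m j|)%N.
Hypothesis m_separated : forall j k j' k' (a b : int), (j < k)%N -> (j' < k')%N ->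
  (k < k')%N \/ k = k' /\ (j < j')%N -> (`|a| <= j)%N -> (`|b| <= j')%N ->
  m j - m k + a <> m j' - m k' + b.
Hypothesis h_large : forall k j (i : int), (k < j)%N -> (`|i| <= j)%N ->
  (2 * j + `|m k| <= h (m j + i)%R)%N.

(** The idea is the decomposition [xE] of a translate of [x] into the earlier
    copies [u k], the target scheduled at time [k], and the later copies
    [r k]. *)
Lemma weakly_dense_translates : exists x : ell2 R,
  forall O : set (weak_space (ell2 R)), open O -> O !=set0 ->
  exists k, O (wshift h (m k) x).
Proof.
have [y [y_supp y_norm y_sum y_dense]] := exists_target_schedule R h.
pose p j := wpatch h (- m j) (y j).
have yle j : ell2_rnorm (y j) <= 2 ^+ j.
  rewrite -ler_sqr ?nnegrE ?ell2_rnorm_ge0 ?exprn_ge0//.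
  apply: le_trans (y_norm j) _; rewrite -exprM -natrX ler_nat.
  by apply: leq_trans (ltn_expl j (isT : 1 < 2)%N) _; rewrite leq_exp2l// leq_pmulr.
have p_loc j i : (`|i| < j)%N -> p j i = 0.
  move=> ij; rewrite wpatchE; have [->|/y_supp] := eqVneq (y j (i - m j)) 0.
    by rewrite mulr0.
  by have := m_large j; lia.
have p_small k j : (k < j)%N ->
    ell2_rnorm (p j) <= (2 ^+ `|m k|%N)^-1 * (2 ^+ j)^-1.
  move=> kj; have := @wpatch_small R h (- m j) (y j) (2 * j + `|m k|)%N.
  rewrite -/(p j) => /(_ _)/le_trans; apply.
    move=> i /y_supp ij; have := h_large kj ij.
    by rewrite addrCA subrr addr0.
  apply: (@le_trans _ _ ((2 ^+ (2 * j + `|m k|)%N)^-1 * 2 ^+ j)).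
    by rewrite ler_wpM2l// invr_ge0 exprn_ge0.
  rewrite mul2n -addnn !exprD !invfM.
  rewrite [leLHS](_ : _ = (2 ^+ `|m k|%N)^-1 * (2 ^+ j)^-1)//.
  by field; rewrite !expf_neq0 ?pnatr_eq0.
have tail k K : ell2_rnorm (\sum_(k.+1 <= j < K) p j) <=
    (2 ^+ `|m k|%N)^-1 * (2 ^+ k)^-1.
  apply: le_trans (ell2_rnorm_sum _ _ _) _.
  apply: (@le_trans _ _ (\sum_(k.+1 <= j < K) (2 ^+ `|m k|%N)^-1 * (2 ^+ j)^-1)).
    by apply: ler_sum_nat => j /andP[kj _]; exact: p_small.
  by rewrite -mulr_sumr ler_wpM2l ?invr_ge0 ?exprn_ge0// sum_geo_le.
have [||x xP] := @locally_finite_series R p p_loc (ell2_rnorm (p 0%N) + 1).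
- by rewrite addr_ge0 ?ell2_rnorm_ge0.
- case=> [|K]; first by rewrite big_geq// ell2_rnorm0 addr_ge0 ?ell2_rnorm_ge0.
  rewrite big_ltn//; apply: le_trans (ell2_rnormD _ _) _; rewrite lerD2l.
  apply: le_trans (tail 0%N K.+1) _; rewrite expr0 invr1 mulr1.
  by rewrite invf_le1 ?exprn_gt0// exprn_ege1// ler1n.
exists x => O oO [z Oz]; have [L [e e0 Le]] := weak_nbhs_gauge oO Oz.
pose v k j := wpatch h (m k - m j) (y j).
pose u k := \sum_(j < k) v k j.
pose r k := wshift h (m k) (x - \sum_(0 <= j < k.+1) p j).
have xE k : wshift h (m k) x = u k + wpatch h 0 (y k) + r k.
  rewrite -[in LHS](subrK (\sum_(0 <= j < k.+1) p j) x) raddfD addrC.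
  congr (_ + _); rewrite big_nat_recr// raddfD big_mkord raddf_sum.
  have pE j : wshift h (m k) (p j) = v k j by rewrite /p wshift_wpatch addrC.
  congr (_ + _); first by apply: eq_bigr => j _; exact: pE.
  have -> : wpatch h 0 (y k) = v k k by rewrite /v subrr.
  exact: pE.
have rk k : ell2_rnorm (r k) <= (2 ^+ k)^-1.
  apply: le_trans (wshift_bounded _ _ _) _.
  rewrite -ler_pdivlMl ?exprn_gt0//; apply: xP.
    by rewrite mulr_ge0// invr_ge0 exprn_ge0.
  exact: tail.
have v_supp k j i : v k j i != 0 ->
    exists2 a : int, (`|a| <= j)%N & i = m j - m k + a.
  rewrite /v wpatchE; have [->|/y_supp ij] := eqVneq (y j (i + (m k - m j))) 0.
    by rewrite mulr0 eqxx.
  by exists (i + (m k - m j)) => //; ring.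
have v_disj k j j' : (j < j')%N -> (j' < k)%N -> disjoint_supp (v k j) (v k j').
  move=> jj' jk i; have [->|/v_supp[a aj ia]] := eqVneq (v k j i) 0; first by left.
  right; apply/eqP; apply: contraT => /v_supp[b bj ib]; exfalso.
  apply: (@m_separated j k j' k a b) => //; first exact: ltn_trans jk.
    by right.
  by rewrite -ia -ib.
have u_norm k : ell2_rnorm (u k) ^+ 2 <= (2 * k)%:R.
  pose v' j := if (j < k)%N then v k j else 0.
  have -> : u k = \sum_(j < k) v' j by apply: eq_bigr => j _; rewrite /v' ltn_ord.
  rewrite ell2_pythagoras_sum => [|j j' jj' i].
    apply: le_trans (y_sum k); apply: ler_sum => j _; rewrite /v' ltn_ord.
    by rewrite ler_sqr ?nnegrE ?ell2_rnorm_ge0 ?wpatch_contraction.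
  rewrite /v'; case: (ltnP j' k) => [jk|_]; last by right.
  by rewrite (ltn_trans jj' jk); exact: v_disj.
have u_disj k k' : (k < k')%N -> disjoint_supp (u k) (u k').
  move=> kk' i; rewrite /u !ell2_bigsum.
  have [->|ui] := eqVneq (\sum_(j < k) v k j i) 0; [by left|right].
  have [/existsP[j vj]|] := boolP [exists j : 'I_k, v k j i != 0]; last first.
    rewrite negb_exists => /forallP v0; move: ui; rewrite big1 ?eqxx// => j _.
    by apply/eqP; have := v0 j; rewrite negbK.
  rewrite big1// => j' _; apply/eqP; apply: contraT => /v_supp[b bj ib].
  have [a aj ia] := v_supp _ _ _ vj; exfalso.
  by apply: (@m_separated j k j' k' a b) => //; [left|rewrite -ia -ib].
(* The gauge is at most 2 gauge (u k) + 2 K (2 d)^2; both terms are made at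
   most e / 4. *)
have [K K0 KL] := gauge_bounded L.
pose d := Order.min 1 (e / (32 * K)).
have d0 : 0 < d by rewrite lt_min ltr01 divr_gt0// mulr_gt0.
have d_sqr : 8 * K * d ^+ 2 <= e / 4.
  apply: (@le_trans _ _ (8 * K * d)).
    rewrite ler_wpM2l ?mulr_ge0 ?(ltW K0)// expr2 ler_piMr ?(ltW d0)//.
    by rewrite ge_min lexx.
  apply: (@le_trans _ _ (8 * K * (e / (32 * K)))).
    by rewrite ler_wpM2l ?mulr_ge0 ?(ltW K0)// ge_min lexx orbT.
  rewrite le_eqVlt; apply/orP; left; apply/eqP; field; rewrite gt_eqF//.
(* The times k t show one target close to z; since k t is less than
   2 a (t + 1), the squared norms of the u (k t) grow at most linearly in t. *)
have [a a0 ya] := y_dense z d d0.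
pose k t := (a * t.*2.+1).-1.
have kS t : (k t).+1 = (a * t.*2.+1)%N by rewrite prednK// muln_gt0 a0.
have k_mono t t' : (t < t')%N -> (k t < k t')%N.
  by move=> tt'; rewrite -ltnS !kS ltn_pmul2l// ltnS ltn_double.
have k_ge t : (t <= k t)%N.
  by rewrite -ltnS kS; apply: (@leq_trans t.*2.+1); [lia|rewrite leq_pmull].
have e8 : 0 < e / 8 by lra.
have [||t Nt ut] := @gauge_small_along R L (fun t => u (k t)) (4 * a)%:R _
    (Num.bound d^-1) _ _ e8.
- by move=> i j /k_mono/u_disj.
- move=> t; apply: le_trans (u_norm _) _; rewrite -natrM ler_nat.
  by have := kS t; nia.
have rkt : ell2_rnorm (r (k t)) <= d.
  apply: le_trans (rk _) _; rewrite -[leRHS]invrK lef_pV2 ?posrE ?exprn_gt0 ?invr_gt0//.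
  have di : 0 <= d^-1 by rewrite invr_ge0 ltW.
  apply: le_trans (ltW (archi_boundP di)) _; rewrite -natrX ler_nat.
  by apply: leq_trans (leq_trans Nt (k_ge t)) _; rewrite ltnW// ltn_expl.
have rest : ell2_rnorm (wpatch h 0 (y (k t)) - z + r (k t)) <= d + d.
  by apply: le_trans (ell2_rnormD _ _) _; exact: lerD (ltW (ya t)) rkt.
exists (k t); apply: Le; rewrite xE -!addrA [r _ - z]addrC.
rewrite (addrA (wpatch h 0 _)); apply: le_lt_trans (gaugeD _ _ _) _.
have g1 := KL (wpatch h 0 (y (k t)) - z + r (k t)).
have g2 : K * ell2_rnorm (wpatch h 0 (y (k t)) - z + r (k t)) ^+ 2 <=
    K * (d + d) ^+ 2.
  by rewrite ler_wpM2l ?(ltW K0)// ler_sqr ?nnegrE ?ell2_rnorm_ge0 ?addr_ge0 ?(ltW d0).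
have dd : K * (d + d) ^+ 2 = 4 * K * d ^+ 2 by ring.
by have := le_trans g1 g2; rewrite dd; lra.
Qed.
End weak_hypercyclicity.

(** * A profile that works in both directions *)

(** The blocks [4 ^ k, 4 ^ k.+1] carry a tent when the parity of [k] is [b] and
    nothing otherwise, so the functions for the two values of [b] have disjoint
    supports while each contains tents of unbounded height. *)
Definition tent (b : bool) (p : nat) : nat :=
  let k := trunc_log 4 p in
  if odd k == b then minn (p - 4 ^ k) (4 ^ k.+1 - p) else 0%N.

(** Valid on the closed block, where both formulas vanish at the right end;
    consecutive integers therefore always share a block. *)
Lemma tentE b k p : (4 ^ k <= p <= 4 ^ k.+1)%N ->
  tent b p = if odd k == b then minn (p - 4 ^ k) (4 ^ k.+1 - p) else 0%N.
Proof.
move=> /andP[kp]; rewrite leq_eqVlt => /predU1P[->|pk].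
  by rewrite /tent trunc_expnK// !subnn min0n minn0 !if_same.
by rewrite /tent (@trunc_log_eq 4 k p)// kp.
Qed.

Lemma tent_step b p : (tent b p.+1 <= (tent b p).+1)%N /\ (tent b p <= (tent b p.+1).+1)%N.
Proof.
case: p => [|p]; first by case: b.
have /(_ isT isT)/andP[k1 k2] := @trunc_log_bounds 4 p.+1.
rewrite !(@tentE b (trunc_log 4 p.+1)) ?k1 ?(ltnW k2) ?(leq_trans k1)//.
by case: ifP => _; lia.
Qed.

Lemma tent_alternate p : tent false p = 0%N \/ tent true p = 0%N.
Proof. by rewrite /tent; case: (odd _); [left|right]. Qed.

Lemma tent_double b k : odd k = b -> tent b (2 * 4 ^ k) = (4 ^ k)%N.
Proof.
by move=> kb; rewrite (@tentE b k) ?kb ?eqxx ?expnS; lia.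
Qed.

Definition profile_fun (i : int) : nat :=
  match i with Posz n => tent false n | Negz n => tent true n.+1 end.

Lemma profile_neg n : profile_fun (- n%:Z) = tent true n.
Proof. by case: n => [|n]; [rewrite oppr0|rewrite -NegzE]. Qed.

Lemma profile_step i : (profile_fun (i + 1) <= (profile_fun i).+1)%N /\
  (profile_fun i <= (profile_fun (i + 1)).+1)%N.
Proof.
case: i => n.
  by rewrite -PoszD addn1; exact: tent_step.
have -> : Negz n + 1 = - n%:Z by rewrite NegzE -addn1 PoszD opprD subrK.
rewrite profile_neg -[profile_fun (Negz n)]/(tent true n.+1).
by have [] := tent_step true n.
Qed.

Lemma profile_lip (i d : int) : (profile_fun (i + d) <= profile_fun i + `|d|)%N.
Proof.
have up k : (profile_fun (i + k%:Z) <= profile_fun i + k)%N.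
  elim: k => [|k IHk]; first by rewrite addr0 addn0.
  have [+ _] := profile_step (i + k%:Z).
  by rewrite -addrA -PoszD addn1 addnS => /leq_trans; apply; rewrite ltnS.
have down k : (profile_fun (i - k%:Z) <= profile_fun i + k)%N.
  elim: k => [|k IHk]; first by rewrite oppr0 addr0 addn0.
  have [_] := profile_step (i - k.+1%:Z).
  rewrite -{2}addn1 PoszD opprD addrA subrK addnS => /leq_trans; apply.
  by rewrite ltnS.
by case: d => n; [exact: up|rewrite NegzE abszN; exact: down].
Qed.

Definition profile := Lipweight profile_lip.

(** The exponents [j.*2 + b] pick the blocks of parity [b].  Position
    [2 * 4 ^ k] has height [4 ^ k], half its distance to the origin, while the
    previous visit is only at a sixteenth of this distance: this is what
    [h_large] asks for. *)
Definition visit_time (b : bool) j : nat := (2 * 4 ^ (j.*2 + b))%N.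
Definition visit (b : bool) j : int := (-1) ^+ b * (visit_time b j)%:Z.

Lemma visitE b j :
  visit b j = if b then - (visit_time b j)%:Z else (visit_time b j)%:Z.
Proof. by rewrite /visit; case: b; rewrite ?expr1 ?mulN1r ?expr0 ?mul1r. Qed.

Lemma visit_time_gt0 b j : (0 < visit_time b j)%N.
Proof. by rewrite muln_gt0 expn_gt0. Qed.

Lemma visit_time_ge b j : (32 * j <= visit_time b j)%N.
Proof.
rewrite /visit_time expnD -mul2n expnM; case: j => [|j]; first by rewrite muln0.
have jlt : (j < 16 ^ j)%N by exact: ltn_expl.
have b0 : (0 < 4 ^ b)%N by rewrite expn_gt0.
rewrite expnS -[(4 ^ 2)%N]/16%N; nia.
Qed.

Lemma visit_time_mono b k j : (k < j)%N -> (16 * visit_time b k <= visit_time b j)%N.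
Proof.
move=> kj; rewrite /visit_time mulnCA leq_mul2l /= (_ : 16 = 4 ^ 2)%N// -expnD.
by rewrite leq_exp2l//; lia.
Qed.

Lemma profile_visit b j (i : int) : (`|i| <= j)%N ->
  (visit_time b j <= 2 * (profile_fun (visit b j + i) + j))%N.
Proof.
move=> ij; have : (profile_fun (visit b j) = 4 ^ (j.*2 + b))%N.
  rewrite /visit; case: b; rewrite ?expr1 ?mulN1r ?profile_neg ?expr0 ?mul1r;
    by apply: tent_double; rewrite oddD odd_double.
have := profile_lip (visit b j + i) (- i); rewrite addrK abszN /visit_time; lia.
Qed.

Lemma weakly_dense_profile (R : realType) (b : bool) : exists x : ell2 R,
  forall O : set (weak_space (ell2 R)), open O -> O !=set0 ->
  exists k, O (wshift profile (visit b k) x).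
Proof.
apply: weakly_dense_translates.
- move=> j; have := visit_time_ge b j; rewrite !visitE; case: b; lia.
- move=> j k j' k' a c jk jk' H aj cj.
  have := visit_time_mono b jk; have := visit_time_mono b jk'.
  have := visit_time_ge b j; have := visit_time_ge b j'.
  have {H} : (16 * visit_time b k <= visit_time b k')%N \/
      visit_time b k = visit_time b k' /\ (16 * visit_time b j <= visit_time b j')%N.
    by case: H => [/(visit_time_mono b)|[-> /(visit_time_mono b)]]; [left|right].
  rewrite !visitE; have := visit_time_gt0 b j'; have := visit_time_gt0 b k'.
  move: (visit_time b j) (visit_time b k) (visit_time b j') (visit_time b k').
  by move=> p q p' q'; case: b; lia.
- move=> k j i kj ij; have := profile_visit b ij.
  have := visit_time_mono b kj; have := visit_time_ge b j.
  have -> : (`|visit b k| = visit_time b k)%N by rewrite !visitE; case: b; lia.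
  by move: (visit_time b k) (visit_time b j) (visit b j) => /= ? ? ?; lia.
Qed.

Lemma wshift_weakly_hypercyclic (R : realType) (b : bool) :
  weakly_hypercyclic (@wshift R profile ((-1) ^+ b)).
Proof.
have [x xP] := weakly_dense_profile R b; exists x => O O0 oO.
have [k Ok] := xP O oO O0; exists (wshift profile (visit b k) x); split => //.
by exists (visit_time b k); rewrite // iter_wshift.
Qed.

Theorem proposition1p8 (R : realType) :
  exists T S : {linear ell2 R -> ell2 R},
    [/\ bilateral_weighted_shift T,
        inverse_operator T S,
        ~ hypercyclic T,
        weakly_hypercyclic T &
        weakly_hypercyclic S].
Proof.
exists (@wshift R profile 1), (@wshift R profile (-1)); split.
- exact: wshift1_bilateral.
- split; [exact: wshiftK|exact: wshiftNK|exact: wshift_bounded_operator].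
- apply: wshift_not_hypercyclic => n; rewrite /= profile_neg; exact: tent_alternate.
- exact: (wshift_weakly_hypercyclic R false).
- exact: (wshift_weakly_hypercyclic R true).
Qed.
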